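(* Let $\Omega$ be a compact Hausdorff space and $X$ a real or complex Banach space. Let $f\in S(C(\Omega,X))$ and $\Lambda=\{\omega\in\Omega:\|f(\omega)\|=1\}$. If $\Lambda$ is finite and $S_{f(\omega)}$ is weakly compact for each $\omega\in\Lambda$, then $S_f$ is weakly compact. In addition, if we assume $\overline{\mathrm{ext}(X_1^* )}^{\,w^*}\subseteq S(X^* )$, then the converse is also true; that is, if $S_f$ is weakly compact, then $\Lambda$ is finite and $S_{f(\omega)}$ is weakly compact for each $\omega\in\Lambda$.
   Context: $C(\Omega,X)$ is the Banach space of $X$-valued continuous functions on $\Omega$ with the supremum norm. For a Banach space $E$, $S(E)$ is its unit sphere, and for $e\in S(E)$ the state space is $S_e=\{e^*\in S(E^* ):e^*(e)=1\}\subseteq E^*$; $S_f$ is taken with $E=C(\Omega,X)$ and $S_{f(\omega)}$ (for $\omega\in\Lambda$) with $E=X$. $X_1^*$ is the closed unit ball of $X^*$, $\mathrm{ext}$ denotes the set of extreme points, and $\overline{\,\cdot\,}^{\,w^*}$ denotes closure in the weak$^*$ topology. Weakly compact means compact in the weak topology $\sigma(E^*,E^{**})$ of the corresponding dual space. *)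

(* Defs.v *)
From HB Require Import structures.
From mathcomp Require Import all_boot all_order all_algebra.
From mathcomp Require Import all_classical all_reals all_analysis.
From mathcomp Require Import complex.

Set Implicit Arguments.
Unset Strict Implicit.
Unset Printing Implicit Defensive.

Import Order.TTheory GRing.Theory Num.Theory.
Import numFieldTopology.Exports numFieldNormedType.Exports.

Local Open Scope classical_set_scope.
Local Open Scope ring_scope.

Inductive scalar_kind : Set := RealScalars | ComplexScalars.

Definition scalars (R : realType) (k : scalar_kind) : numFieldType :=
  match k with
  | RealScalars => R
  | ComplexScalars => complex R
  end.

(* Norms in MathComp-Analysis take their values in the scalar field K itself,
   so over the complex numbers a supremum of norms is a supremum for the
   partial order of K (where x <= y means that y - x is a nonnegative real).
   This is the least upper bound property that makes such suprema exist. *)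
Lemma scalars_supremums_neq0 (R : realType) (k : scalar_kind)
    (A : set (scalars R k)) (M : scalars R k) :
  A !=set0 -> (forall x, A x -> 0 <= x <= M) -> supremums A !=set0.
Proof.
case: k A M => /= A M [a Aa] AM.
- have Asup : has_sup A.
    by split; [exists a|exists M => x /AM/andP[]].
  exists (sup A); split; first exact: sup_upper_bound.
  by move=> y yA; apply: ge_sup => //; exists a.
- pose B : set R := [set complex.Re x | x in A].
  have AE x : A x -> x = (complex.Re x)%:C%C.
    by move=> /AM/andP[]; case: x => u v; rewrite lecE /= => /andP[/eqP -> _] _.
  have Bub u : (exists2 v, v = complex.Re u & ubound A u) ->
      ubound B (complex.Re u).
    move=> [_ _ uA] _ [x Ax <-]; have := uA x Ax.
    by rewrite lecE => /andP[].
  have Bsup : has_sup B.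
    split; first by exists (complex.Re a), a.
    exists (complex.Re M); apply: Bub; exists (complex.Re M) => // x.
    by move=> /AM/andP[].
  exists (sup B)%:C%C; split.
    move=> x Ax; rewrite (AE x Ax) lecR; apply: sup_upper_bound => //.
    by exists x.
  move=> y yA; have := yA _ Aa; rewrite (AE a Aa).
  case: y yA => u v yA; rewrite !lecE /= => /andP[/eqP v0 _].
  rewrite v0 eqxx /=; apply: ge_sup; first by exists (complex.Re a), a.
  by apply: (Bub (u +i* v)%C); exists u.
Qed.

Section supremum_theory.
Context {R : realType} {k : scalar_kind}.
Local Notation K := (scalars R k).
Implicit Types (A : set K) (M x : K).

Lemma scalars_supremumP A M :
  A !=set0 -> (forall x, A x -> 0 <= x <= M) -> supremums A (supremum 0 A).
Proof.
move=> A0 AM; rewrite /supremum ifF; last first.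
  by apply/negbTE; apply/set0P.
case: xgetP => // noA; have [s sA] := scalars_supremums_neq0 A0 AM.
by have := noA s sA.
Qed.

Lemma scalars_supremum_ub A M x :
  (forall y, A y -> 0 <= y <= M) -> A x -> x <= supremum 0 A.
Proof.
by move=> AM Ax; have [+ _] := scalars_supremumP (ex_intro _ x Ax) AM; apply.
Qed.

Lemma scalars_supremum_le A M :
  A !=set0 -> (forall y, A y -> 0 <= y <= M) -> supremum 0 A <= M.
Proof.
move=> A0 AM; have [_] := scalars_supremumP A0 AM; apply.
by move=> y /AM/andP[].
Qed.

Lemma scalars_supremumZ A M (c : K) : 0 <= c ->
  A !=set0 -> (forall y, A y -> 0 <= y <= M) ->
  supremum 0 [set c * x | x in A] = c * supremum 0 A.
Proof.
move=> c0 A0 AM; have [a Aa] := A0.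
have cAM y : [set c * x | x in A] y -> 0 <= y <= c * supremum 0 A.
  move=> [x Ax <-]; have /andP[x0 _] := AM _ Ax.
  by rewrite mulr_ge0//= ler_wpM2l//; exact: scalars_supremum_ub AM Ax.
have cA0 : [set c * x | x in A] !=set0 by exists (c * a), a.
apply/eqP; rewrite eq_le (scalars_supremum_le cA0 cAM)/=.
have [cE|cN0] := eqVneq c 0.
  have : [set c * x | x in A] (c * a) by exists a.
  by move/(scalars_supremum_ub cAM); rewrite cE !mul0r.
have {cN0}c0 : 0 < c by rewrite lt0r cN0.
rewrite mulrC -ler_pdivlMr//; have [_] := scalars_supremumP A0 AM; apply.
move=> x Ax; rewrite ler_pdivlMr// mulrC.
by apply: (scalars_supremum_ub cAM); exists x.
Qed.

End supremum_theory.

(* The space C(Omega, X).  The supremum norm is only meaningful for compact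
   Omega, which is why the compactness proof is a parameter of the type. *)
Definition contfun (Omega : topologicalType) (cO : compact [set: Omega])
  (X : topologicalType) : Type := continuousType Omega X.

Definition contfun_apply (Omega : topologicalType) (cO : compact [set: Omega])
  (X : topologicalType) (f : contfun cO X) : Omega -> X :=
  (f : continuousType Omega X).
Coercion contfun_apply : contfun >-> Funclass.

Section contfun.
Context {R : realType} {k : scalar_kind}.
Local Notation K := (scalars R k).
Context {Omega : topologicalType} (cO : compact [set: Omega]).
Context (X : normedModType K).
Local Notation CX := (contfun cO X).
Implicit Types (f g h : CX).

Lemma contfun_continuous f : continuous f.
Proof. exact: cts_fun. Qed.

Lemma contfun_ext f g : f =1 g -> f = g.
Proof. by move=> fg; apply/continuousEP. Qed.

Definition contfun_of (f : Omega -> X) (fc : continuous f) : CX :=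
  (mkcts fc : continuousType Omega X).

HB.instance Definition _ := Choice.copy CX (continuousType Omega X).

Let zero_cts : continuous (fun _ : Omega => 0 : X).
Proof. by move=> w; exact: cvg_cst. Qed.
Let opp_cts f : continuous (fun w => - f w).
Proof. by move=> w; apply: cvgN; exact: contfun_continuous. Qed.
Let add_cts f g : continuous (fun w => f w + g w).
Proof. by move=> w; apply: cvgD; exact: contfun_continuous. Qed.
Let scale_cts (c : K) f : continuous (fun w => c *: f w).
Proof. by move=> w; apply: cvgZl_tmp; exact: contfun_continuous. Qed.

Let zero := contfun_of zero_cts.
Let opp f := contfun_of (@opp_cts f).
Let add f g := contfun_of (@add_cts f g).
Let scale (c : K) f := contfun_of (@scale_cts c f).

Let addA : associative add.
Proof. by move=> f g h; apply: contfun_ext => w; exact: addrA. Qed.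
Let addC : commutative add.
Proof. by move=> f g; apply: contfun_ext => w; exact: addrC. Qed.
Let add0 : left_id zero add.
Proof. by move=> f; apply: contfun_ext => w; exact: add0r. Qed.
Let addN : left_inverse zero opp add.
Proof. by move=> f; apply: contfun_ext => w; exact: addNr. Qed.

HB.instance Definition _ := GRing.isZmodule.Build CX addA addC add0 addN.

Let scaleA (a b : K) f : scale a (scale b f) = scale (a * b) f.
Proof. by apply: contfun_ext => w; exact: scalerA. Qed.
Let scale1 : left_id 1 scale.
Proof. by move=> f; apply: contfun_ext => w; exact: scale1r. Qed.
Let scaleDr : right_distributive scale +%R.
Proof. by move=> a f g; apply: contfun_ext => w; exact: scalerDr. Qed.
Let scaleDl f : {morph scale^~ f : a b / a + b}.
Proof. by move=> a b; apply: contfun_ext => w; exact: scalerDl. Qed.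

HB.instance Definition _ :=
  GRing.Zmodule_isLmodule.Build K CX scaleA scale1 scaleDr scaleDl.

Definition contfun_norm f : K := supremum 0 (range (fun w => `|f w|)).

Lemma contfun_bounded f : exists M, forall x,
  range (fun w => `|f w|) x -> 0 <= x <= M.
Proof.
have /compact_near_coveringP cov := cO.
have fM : \forall M \near +oo_K, [set: Omega] `<=` (fun w => `|f w| <= M).
  apply: cov => w _.
  exists ([set u | `|f u| <= `|f w| + 1], [set M | `|f w| + 1 <= M]); last first.
    by move=> [u M] [/=]; exact: le_trans.
  split => /=.
    apply: (cvgr_norm_le (f w)); last by rewrite ltrDl.
    exact: contfun_continuous.
  by apply: nbhs_pinfty_ge; rewrite ger0_real// addr_ge0.
have [M _ {}fM] := pinfty_ex_gt0 fM.
by exists M => _ [w _ <-]; rewrite normr_ge0/=; exact: fM.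
Qed.

Lemma contfun_norm_ub f w : `|f w| <= contfun_norm f.
Proof.
have [M fM] := contfun_bounded f.
by apply: (scalars_supremum_ub fM); exists w.
Qed.

Lemma contfun_norm_ge0 f : 0 <= contfun_norm f.
Proof.
have [E0|/set0P[w _]] := eqVneq [set: Omega] set0.
  by rewrite /contfun_norm E0 image_set0 supremum0.
exact: le_trans (normr_ge0 _) (contfun_norm_ub f w).
Qed.

Lemma contfun_norm_le f M : 0 <= M -> (forall w, `|f w| <= M) ->
  contfun_norm f <= M.
Proof.
move=> M0 fM.
have [E0|/set0P[w _]] := eqVneq [set: Omega] set0.
  by rewrite /contfun_norm E0 image_set0 supremum0.
apply: scalars_supremum_le; first by exists `|f w|, w.
by move=> _ [u _ <-]; rewrite normr_ge0 fM.
Qed.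

Let normD f g : contfun_norm (f + g) <= contfun_norm f + contfun_norm g.
Proof.
apply: contfun_norm_le; first by rewrite addr_ge0 ?contfun_norm_ge0.
by move=> w; rewrite (le_trans (ler_normD _ _))// lerD// contfun_norm_ub.
Qed.

Let normZ (c : K) f : contfun_norm (c *: f) = `|c| * contfun_norm f.
Proof.
have [E0|/set0P[w _]] := eqVneq [set: Omega] set0.
  by rewrite /contfun_norm E0 !image_set0 supremum0 mulr0.
have [M fM] := contfun_bounded f.
rewrite -(scalars_supremumZ (normr_ge0 c) _ fM); last by exists `|f w|, w.
congr (supremum 0 _); rewrite image_comp; apply: eq_imagel => u _ /=.
by rewrite -normrZ.
Qed.

Let norm0_eq0 f : contfun_norm f = 0 -> f = 0.
Proof.
move=> f0; apply: contfun_ext => w; apply/eqP.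
by rewrite -normr_le0 -f0 contfun_norm_ub.
Qed.

HB.instance Definition _ :=
  Lmodule_isNormed.Build K CX normD normZ norm0_eq0.

Lemma contfun_normE f : `|f| = supremum 0 (range (fun w => `|f w|)).
Proof. by []. Qed.

End contfun.

Definition unit_ball (K : numFieldType) (E : normedModType K) : set E :=
  [set x | `|x| <= 1].
Arguments unit_ball {K} E.

Definition unit_sphere (K : numFieldType) (E : normedModType K) : set E :=
  [set x | `|x| = 1].
Arguments unit_sphere {K} E.

Record dual (R : realType) (k : scalar_kind)
    (E : normedModType (scalars R k)) := Dual {
  dual_linear :> {linear E -> (scalars R k)^o};
  dual_continuous : continuous dual_linear
}.

Section dual.
Context {R : realType} {k : scalar_kind}.
Local Notation K := (scalars R k).
Context (E : normedModType K).
Implicit Types (phi psi chi : dual E).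

Lemma dual_ext phi psi : phi =1 psi -> phi = psi.
Proof.
case: phi psi => [[f fl] fc] [[g gl] gc] /= /funext fg.
have {}fg : f = g by []; subst g.
have flgl : fl = gl.
  case: fl gl {fc gc} => [[fD] [fZ]] [[gD] [gZ]].
  by rewrite (Prop_irrelevance fD gD) (Prop_irrelevance fZ gZ).
by subst gl; rewrite (Prop_irrelevance fc gc).
Qed.

HB.instance Definition _ := gen_eqMixin (dual E).
HB.instance Definition _ := gen_choiceMixin (dual E).

Let zero_cts : continuous (\0 : {linear E -> K^o}).
Proof. by move=> x; exact: cvg_cst. Qed.
Let opp_cts phi : continuous (\- phi : {linear E -> K^o}).
Proof. by move=> x; apply: cvgN; exact: dual_continuous. Qed.
Let add_cts phi psi : continuous (phi \+ psi : {linear E -> K^o}).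
Proof. by move=> x; apply: cvgD; exact: dual_continuous. Qed.
Let scale_cts (c : K) phi : continuous (c \*: phi : {linear E -> K^o}).
Proof. by move=> x; apply: cvgZl_tmp; exact: dual_continuous. Qed.

Let zero := Dual zero_cts.
Let opp phi := Dual (@opp_cts phi).
Let add phi psi := Dual (@add_cts phi psi).
Let scale (c : K) phi := Dual (@scale_cts c phi).

Let addA : associative add.
Proof. by move=> phi psi chi; apply: dual_ext => x; exact: addrA. Qed.
Let addC : commutative add.
Proof. by move=> phi psi; apply: dual_ext => x; exact: addrC. Qed.
Let add0 : left_id zero add.
Proof. by move=> phi; apply: dual_ext => x; exact: add0r. Qed.
Let addN : left_inverse zero opp add.
Proof. by move=> phi; apply: dual_ext => x; exact: addNr. Qed.

HB.instance Definition _ := GRing.isZmodule.Build (dual E) addA addC add0 addN.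

Let scaleA (a b : K) phi : scale a (scale b phi) = scale (a * b) phi.
Proof. by apply: dual_ext => x; exact: scalerA. Qed.
Let scale1 : left_id 1 scale.
Proof. by move=> phi; apply: dual_ext => x; exact: scale1r. Qed.
Let scaleDr : right_distributive scale +%R.
Proof. by move=> a phi psi; apply: dual_ext => x; exact: scalerDr. Qed.
Let scaleDl phi : {morph scale^~ phi : a b / a + b}.
Proof. by move=> a b; apply: dual_ext => x; exact: scalerDl. Qed.

HB.instance Definition _ :=
  GRing.Zmodule_isLmodule.Build K (dual E) scaleA scale1 scaleDr scaleDl.

Definition dual_norm phi : K :=
  supremum 0 [set `|phi x| | x in unit_ball E].

Let image_neq0 phi : [set `|phi x| | x in unit_ball E] !=set0.
Proof. by exists `|phi 0|, 0 => //; rewrite /unit_ball/= normr0. Qed.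

Lemma dual_bounded phi : exists M, forall y,
  [set `|phi x| | x in unit_ball E] y -> 0 <= y <= M.
Proof.
have /linear_bounded_continuous := @dual_continuous _ _ _ phi.
move=> /bounded_funP /(_ 1) [M phiM].
by exists M => _ [x x1 <-]; rewrite normr_ge0 phiM.
Qed.

Lemma dual_norm_ge0 phi : 0 <= dual_norm phi.
Proof.
have [M phiM] := dual_bounded phi.
apply: (scalars_supremum_ub phiM); exists 0; first by rewrite /unit_ball/= normr0.
by rewrite linear0 normr0.
Qed.

Lemma dual_norm_ub phi x : `|phi x| <= dual_norm phi * `|x|.
Proof.
have [->|x0] := eqVneq x 0; first by rewrite linear0 !normr0 mulr0.
have [M phiM] := dual_bounded phi.
rewrite -ler_pdivrMr ?normr_gt0//.
apply: (scalars_supremum_ub phiM); exists (`|x|^-1 *: x).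
  by rewrite /unit_ball/= normfZV.
by rewrite linearZ/= normrM ger0_norm ?invr_ge0// mulrC.
Qed.

Lemma dual_norm_le phi M : (forall x, `|x| <= 1 -> `|phi x| <= M) ->
  dual_norm phi <= M.
Proof.
move=> phiM; apply: scalars_supremum_le => // _ [x x1 <-].
by rewrite normr_ge0 phiM.
Qed.

Let normD phi psi : dual_norm (phi + psi) <= dual_norm phi + dual_norm psi.
Proof.
apply: dual_norm_le => x x1; rewrite (le_trans (ler_normD _ _))//.
by rewrite lerD// (le_trans (dual_norm_ub _ _))// ler_piMr ?dual_norm_ge0.
Qed.

Let normZ (c : K) phi : dual_norm (c *: phi) = `|c| * dual_norm phi.
Proof.
have [M phiM] := dual_bounded phi.
rewrite -(scalars_supremumZ (normr_ge0 c) _ phiM)//.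
congr (supremum 0 _); rewrite image_comp; apply: eq_imagel => x _ /=.
by rewrite -normrM.
Qed.

Let norm0_eq0 phi : dual_norm phi = 0 -> phi = 0.
Proof.
move=> phi0; apply: dual_ext => x; apply/eqP.
by rewrite -normr_le0 (le_trans (dual_norm_ub _ _))// phi0 mul0r.
Qed.

HB.instance Definition _ :=
  Lmodule_isNormed.Build K (dual E) normD normZ norm0_eq0.

Lemma dual_normE phi : `|phi| = supremum 0 [set `|phi x| | x in unit_ball E].
Proof. by []. Qed.

End dual.

Section weak_topologies.
Context {R : realType} {k : scalar_kind}.
Local Notation K := (scalars R k).

(* The topology sigma(E, E') on E, for E' the dual of E. *)
Definition weak (E : normedModType K) : Type :=
  sup_topology (fun phi : dual E =>
    Topological.class (initial_topology (phi : E -> K^o))).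
HB.instance Definition _ (E : normedModType K) := Topological.on (weak E).

(* The topology sigma(E', E) on the dual E' of E. *)
Definition weak_star (E : normedModType K) : Type :=
  sup_topology (fun x : E =>
    Topological.class (initial_topology (fun phi : dual E => phi x : K^o))).
HB.instance Definition _ (E : normedModType K) := Topological.on (weak_star E).

Definition weakly_compact (E : normedModType K) (A : set E) : Prop :=
  compact (A : set (weak E)).

Definition weak_star_closure (E : normedModType K) (A : set (dual E)) :
    set (dual E) :=
  closure (A : set (weak_star E)).

End weak_topologies.

(* Also for complex scalars t is real here, since 0 < t forces it to be. *)
Definition extreme_points (K : numFieldType) (E : lmodType K) (A : set E) : set E :=
  [set x | A x /\ forall y z (t : K), A y -> A z -> 0 < t < 1 ->
    x = t *: y + (1 - t) *: z -> y = x /\ z = x].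

Definition state_space (R : realType) (k : scalar_kind)
    (E : normedModType (scalars R k)) (e : E) : set (dual E) :=
  [set phi | unit_sphere (dual E) phi /\ phi e = 1].

(* Main.v *)
(* Write L for the peak set of f.  A state phi of f kills every g vanishing on
   L, because the norm of f + t g is 1 + o(t).  If L is finite, phi is therefore
   a sum of functionals psi_w o delta_w for w in L, and bump functions show that
   each psi_w lies in [0,1] S_{f(w)}; so S_f is a weakly closed subset of a
   finite sum of weakly compact sets.
   Conversely, S_{f(w)} is the image under restriction to constant functions of
   a weakly closed part of S_f.  If L had a limit point w0, choose by
   Hahn-Banach states x*_w o delta_w of f for w in L other than w0; a weak
   cluster point phi0 of these as w tends to w0 satisfies phi0 (u f) = 1 for all
   bump functions u at w0, so the element of the bidual "limit of phi (u f) as u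
   shrinks to w0", taken along an ultrafilter, is 1 at phi0 and 0 at all the
   states x*_w o delta_w, a contradiction. *)
Require Import Defs.
From HB Require Import structures.
From mathcomp Require Import all_boot all_order all_algebra.
From mathcomp Require Import all_classical all_reals all_analysis.
From mathcomp Require Import complex.

Import Order.TTheory GRing.Theory Num.Theory.
Import numFieldTopology.Exports numFieldNormedType.Exports.

Local Open Scope classical_set_scope.
Local Open Scope ring_scope.

Set Implicit Arguments.
Unset Strict Implicit.
Unset Printing Implicit Defensive.

(** * Real and complex scalars *)

Lemma Re_le_norm (R : realType) (z : complex R) :
  complex.Re z <= complex.Re `|z|.
Proof.
rewrite normc_def /= (le_trans (ler_norm _))// -sqrtr_sqr ler_wsqrtr//.
by rewrite lerDl sqr_ge0.
Qed.

Lemma Re_eq_norm (R : realType) (z : complex R) :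
  complex.Re z = complex.Re `|z| -> z = `|z|.
Proof.
case: z => u v; rewrite normc_def /= => ur.
have u0 : 0 <= u by rewrite ur sqrtr_ge0.
have : u ^+ 2 = u ^+ 2 + v ^+ 2.
  by rewrite {1}ur sqr_sqrtr// addr_ge0 ?sqr_ge0.
move=> /eqP; rewrite -subr_eq0 opprD addrA subrr add0r oppr_eq0 sqrf_eq0.
by move=> /eqP v0; apply/eqP; rewrite eq_complex /= -ur v0 !eqxx.
Qed.

Section scalars.
Context {R : realType} {k : scalar_kind}.
Local Notation K := (scalars R k).

(** Together with [repart], this inclusion lets both scalar fields be treated at once; after this
    section, cases on [k] return only where the imaginary unit is needed. *)
Definition embed (r : R) : K :=
  match k return scalars R k with
  | RealScalars => r
  | ComplexScalars => (r%:C)%C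
  end.

Definition repart : K -> R :=
  match k return scalars R k -> R with
  | RealScalars => id
  | ComplexScalars => @complex.Re R
  end.

Lemma embed_is_zmod_morphism : zmod_morphism embed.
Proof. by rewrite /embed; case: k => //; exact: rmorphB. Qed.
HB.instance Definition _ := GRing.isZmodMorphism.Build R K embed
  embed_is_zmod_morphism.

Lemma embed_is_monoid_morphism : monoid_morphism embed.
Proof.
rewrite /embed; case: k; first by [].
by split; [exact: rmorph1|exact: rmorphM].
Qed.
HB.instance Definition _ := GRing.isMonoidMorphism.Build R K embed
  embed_is_monoid_morphism.

Lemma repart_is_zmod_morphism : zmod_morphism repart.
Proof. by rewrite /repart; case: k => //= - [a b] [c d]. Qed.
HB.instance Definition _ := GRing.isZmodMorphism.Build K R repart
  repart_is_zmod_morphism.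

Lemma embedK : cancel embed repart.
Proof. by rewrite /embed /repart; case: k. Qed.

Lemma repartM r (z : K) : repart (embed r * z) = r * repart z.
Proof.
move: z; rewrite /embed /repart; case: k => //= -[a b] /=.
by rewrite mul0r subr0.
Qed.

Lemma repart1 : repart 1 = 1.
Proof. by rewrite -(rmorph1 embed) embedK. Qed.

Lemma ler_embed r s : (embed r <= embed s) = (r <= s).
Proof. by rewrite /embed; case: k => //; rewrite lecR. Qed.

Lemma ltr_embed r s : (embed r < embed s) = (r < s).
Proof. by rewrite /embed; case: k => //; rewrite ltcR. Qed.

Lemma embed_ge0 r : (0 <= embed r) = (0 <= r).
Proof. by rewrite -(rmorph0 embed) ler_embed. Qed.

Lemma embed_gt0 r : (0 < embed r) = (0 < r).
Proof. by rewrite -(rmorph0 embed) ltr_embed. Qed.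

Lemma real_repartK (z : K) : z \is Num.real -> embed (repart z) = z.
Proof.
move: z; rewrite /embed /repart; case: k => //= z.
by rewrite realE !lecE; case: z => a b /= /orP[] /andP[/eqP h _]; 
  apply/eqP; rewrite eq_complex /= eqxx /= h.
Qed.

Lemma norm_embed r : `|embed r| = embed `|r|.
Proof.
have [r0|r0] := leP 0 r; first by rewrite ger0_norm ?embed_ge0// ger0_norm.
by rewrite ltr0_norm -?(rmorph0 embed) ?ltr_embed// -rmorphN ltr0_norm.
Qed.

Lemma ler_repart (x y : K) : x <= y -> repart x <= repart y.
Proof.
by move: x y; rewrite /repart; case: k => //= x y; rewrite lecE => /andP[].
Qed.

Lemma repart_le_norm (z : K) : repart z <= repart `|z|.
Proof.
move: z; rewrite /repart; case: k => /= z; first exact: ler_norm.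
exact: Re_le_norm.
Qed.

Lemma norm_repart (z : K) : `|repart z| <= repart `|z|.
Proof.
rewrite ler_norml repart_le_norm andbT lerNl -raddfN.
by rewrite -normrN repart_le_norm.
Qed.

Lemma repart_eq_norm (z : K) : repart z = repart `|z| -> z = `|z|.
Proof. by move: z; rewrite /repart; case: k => //= z; exact: Re_eq_norm. Qed.

(** The real parts of [a] and [1 - a] add up to 1 and are bounded by the moduli, so the hypothesis
    forces equality in both bounds. *)
Lemma norm_add_norm_sub_le1 (a : K) : `|a| + `|1 - a| <= 1 -> a = `|a|.
Proof.
move=> h.
have := ler_repart h; rewrite raddfD/= repart1 => {}h.
have ha := repart_le_norm a.
have := repart_le_norm (1 - a); rewrite raddfB/= repart1 => h1.
have {h1 h} ra : repart a = repart `|a|.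
  apply/eqP; rewrite eq_le ha/=.
  by rewrite -(lerD2r (repart `|1 - a|)) (le_trans h)// -lerBlDl.
exact: repart_eq_norm.
Qed.

Lemma embed_continuous : continuous (embed : R -> K^o).
Proof.
move=> r; apply/cvgrPdist_lt => e e0.
have er : embed (repart e) = e by rewrite real_repartK// gtr0_real.
have re0 : 0 < repart e by rewrite -embed_gt0 er.
near=> s; rewrite -rmorphB norm_embed -er ltr_embed.
by near: s; apply: cvgr_dist_lt.
Unshelve. all: by end_near. Qed.

End scalars.
Arguments embed {R k}.

(** * Weak topologies and adjoints *)

Section dual_constructions.
Context {R : realType} {k : scalar_kind}.
Local Notation K := (scalars R k).

Lemma linear_bound_continuous (E F : normedModType K) (T : {linear E -> F})
  (M : K) : (forall x, `|T x| <= M * `|x|) -> continuous T.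
Proof.
move=> TM; apply: bounded_linear_continuous; apply/bounded_funP => r.
exists (`|M| * r) => x xr; apply: (le_trans (TM x)).
have Mx : 0 <= M * `|x| by exact: le_trans (TM x).
by rewrite -(ger0_norm Mx) normrM normr_id ler_wpM2l.
Qed.

Lemma exists_dual (E : normedModType K) (phi : E -> K) (M : K) :
  (forall a x y, phi (a *: x + y) = a * phi x + phi y) ->
  (forall x, `|phi x| <= M * `|x|) ->
  exists psi : dual E, psi =1 phi.
Proof.
move=> phil phiM.
pose L := GRing.isLinear.Build K E K^o *:%R (phi : E -> K^o) phil.
pose phi' : {linear E -> K^o} := HB.pack (phi : E -> K^o) L.
have phic : continuous phi' by exact: (@linear_bound_continuous _ _ _ M).
by exists (Dual phic).
Qed.

(** The canonical image of [x] in the bidual; it makes evaluation at [x] continuous for the weak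
    topology of [dual E]. *)
Lemma exists_eval (E : normedModType K) (x : E) :
  exists Phi : dual (dual E), forall phi, Phi phi = phi x.
Proof.
apply: (@exists_dual _ (fun phi : dual E => phi x) `|x|) => // phi.
by rewrite mulrC dual_norm_ub.
Qed.

Lemma dual_norm_bound (E : normedModType K) (phi : dual E) x :
  `|phi x| <= `|phi| * `|x|.
Proof. exact: dual_norm_ub. Qed.

(** The adjoint of [T]. *)
Definition dual_comp (E F : normedModType K) (T : {linear E -> F})
    (Tc : continuous T) (phi : dual F) : dual E :=
  @Dual R k E (phi \o T)
    (fun x => continuous_comp (Tc x) (@dual_continuous _ _ _ phi (T x))).

Lemma weak_eval_continuous (E : normedModType K) (phi : dual E) :
  continuous (phi : weak E -> K^o).
Proof.
move=> x; have /cvg_sup/(_ phi) h : (nbhs (x : weak E)) --> (x : weak E) by [].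
move=> A A1; apply: h.
exact: (@initial_continuous _ _ (phi : E -> K^o) x).
Qed.

Lemma continuous_weak (T : topologicalType) (E : normedModType K)
    (g : T -> weak E) :
  (forall phi : dual E, continuous (fun t => phi (g t) : K^o)) -> continuous g.
Proof.
move=> gc t; apply/cvg_sup => phi.
exact: (@continuous_comp_initial _ _ _ (phi : E -> K^o) g (gc phi)).
Qed.

Lemma weak_dual_eval_continuous (E : normedModType K) (x : E) :
  continuous (fun phi : weak (dual E) => (phi : dual E) x : K^o).
Proof.
have [Phi PhiE] := exists_eval x.
by rewrite -(_ : Phi = (fun phi : dual E => phi x) :> (_ -> _)) ?funeqE//;
  exact: weak_eval_continuous.
Qed.

(** An element [Phi] of the bidual of [E] composed with the adjoint is again bounded: it is the
    image [Psi] of [Phi] under the second adjoint. *)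
Lemma weak_dual_comp_continuous (E F : normedModType K) (T : {linear E -> F})
    (Tc : continuous T) :
  continuous (dual_comp Tc : weak (dual F) -> weak (dual E)).
Proof.
have /linear_boundedP/pinfty_ex_gt0[M M0 TM] :=
  (linear_bounded_continuous T).2 Tc.
apply: continuous_weak => Phi.
have [Psi PsiE] : exists Psi : dual (dual F), forall phi,
    Psi phi = Phi (dual_comp Tc phi).
  apply: (@exists_dual _ _ (`|Phi| * M)) => [a phi psi|phi].
    have -> : dual_comp Tc (a *: phi + psi) =
        a *: dual_comp Tc phi + dual_comp Tc psi by exact: dual_ext.
    by rewrite linearP.
  rewrite (le_trans (dual_norm_bound _ _))// -mulrA ler_wpM2l//.
  apply: dual_norm_le => x x1; rewrite (le_trans (dual_norm_bound phi (T x)))//.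
  rewrite mulrC ler_wpM2r// (le_trans (TM _))// ler_piMr// ltW//.
by rewrite -(_ : Psi = (fun phi => Phi (dual_comp Tc phi)) :> (_ -> _))
  ?funeqE//; exact: weak_eval_continuous.
Qed.

Lemma weakD_continuous (E : normedModType K) :
  continuous (fun xy : weak E * weak E => (xy.1 : E) + (xy.2 : E) : weak E).
Proof.
apply: continuous_weak => phi.
rewrite (_ : (fun _ => _) = fun xy : weak E * weak E =>
  (phi (xy.1 : E) : K^o) + phi (xy.2 : E)); last first.
  by apply/funext => xy; rewrite linearD.
move=> xy; apply: cvgD.
  by apply: continuous_comp; [exact: cvg_fst|exact: weak_eval_continuous].
by apply: continuous_comp; [exact: cvg_snd|exact: weak_eval_continuous].
Qed.

Lemma weak_embedZ_continuous (E : normedModType K) :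
  continuous (fun tx : R * weak E => embed tx.1 *: (tx.2 : E) : weak E).
Proof.
apply: continuous_weak => phi.
rewrite (_ : (fun _ => _) = fun tx : R * weak E =>
  (embed tx.1 : K^o) * phi (tx.2 : E)); last first.
  by apply/funext => tx; rewrite linearZ.
move=> tx; apply: cvgM.
  by apply: continuous_comp; [exact: cvg_fst|exact: embed_continuous].
by apply: continuous_comp; [exact: cvg_snd|exact: weak_eval_continuous].
Qed.

Lemma weakly_compact_addset (E : normedModType K) (A B : set E) :
  weakly_compact A -> weakly_compact B ->
  weakly_compact [set x + y | x in A & y in B].
Proof.
move=> Ac Bc; rewrite /weakly_compact.
have -> : [set x + y | x in A & y in B] =
    [set (xy.1 : E) + (xy.2 : E) | xy in (A `*` B : set (weak E * weak E))].
  apply/seteqP; split=> [_ [x Ax [y By <-]]|_ [[x y] [Ax By] <-]].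
    by exists (x, y).
  by exists x => //; exists y.
apply: continuous_compact; last exact: compact_setX.
by apply: continuous_subspaceT; exact: weakD_continuous.
Qed.

(** [C] is the iterated Minkowski sum of the [A i]. Recording only that it contains the sums is
    enough to trap a closed set inside it. *)
Lemma weakly_compact_bigsum (E : normedModType K) (I : eqType) (s : seq I)
    (A : I -> set E) :
  (forall i, i \in s -> weakly_compact (A i)) ->
  exists2 C : set E, weakly_compact C & forall x : I -> E,
    (forall i, i \in s -> A i (x i)) -> C (\sum_(i <- s) x i).
Proof.
elim: s => [_|i s ih Ac].
  exists [set 0]; first exact: compact_set1.
  by move=> x _; rewrite big_nil.
have [j js|C Cc CP] := ih; first by apply: Ac; rewrite in_cons js orbT.
exists [set x + y | x in A i & y in C].
  by apply: weakly_compact_addset => //; apply: Ac; exact: mem_head.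
move=> x Ax; rewrite big_cons; exists (x i).
  by apply: Ax; exact: mem_head.
exists (\sum_(j <- s) x j) => //; apply: CP => j js.
by apply: Ax; rewrite in_cons js orbT.
Qed.

Lemma weakly_compact_cone (E : normedModType K) (A : set E) :
  weakly_compact A ->
  weakly_compact ([set embed t *: x | t in `[0, 1] & x in A] `|` [set 0]).
Proof.
move=> Ac; apply: compactU; last exact: compact_set1.
have -> : [set embed t *: x | t in `[0, 1] & x in A] =
    [set embed tx.1 *: (tx.2 : E) | tx in (`[0, 1] `*` A : set (R * weak E))].
  apply/seteqP; split=> [_ [t t1 [y By <-]]|_ [[x y] [Ax By] <-]].
    by exists (t, y).
  by exists x => //; exists y.
apply: continuous_compact; last first.
  by apply: compact_setX => //; exact: segment_compact.
by apply: continuous_subspaceT; exact: weak_embedZ_continuous.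
Qed.

(** The order on complex scalars is partial, so [c] is taken real to be comparable with norms. The
    ball of radius |x| - c about an outside point [x] misses the set. *)
Lemma closed_norm_le (V : normedModType K) (c : K) :
  c \is Num.real -> closed [set x : V | `|x| <= c].
Proof.
move=> c0 x xcl; have [//|cx] := real_leP (normr_real x) c0.
have xc0 : 0 < `|x| - c by rewrite subr_gt0.
have [y [/= yc xy]] := xcl _ (nbhsx_ballx x _ xc0).
move: xy; rewrite -ball_normE /ball_/= => xy.
have : `|x| - c <= `|x - y|.
  by rewrite (le_trans _ (lerB_dist _ _))// lerD2l lerN2.
by move=> /(lt_le_trans xy); rewrite ltxx.
Qed.

(** Testing on [e] already gives norm at least 1. What remains are conditions on single values of
    [phi], and these are weakly closed. *)
Lemma state_spaceP (E : normedModType K) (e : E) (phi : dual E) : `|e| = 1 ->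
  state_space e phi <-> (forall x, `|phi x| <= `|x|) /\ phi e = 1.
Proof.
move=> e1; split=> [[phi1 phie]|[phi1 phie]].
  by split=> // x; rewrite (le_trans (dual_norm_bound _ _))// phi1 mul1r.
split=> //; apply/eqP; rewrite eq_le; apply/andP; split.
  by apply: dual_norm_le => x; exact: le_trans.
by have := dual_norm_bound phi e; rewrite phie e1 normr1 mulr1.
Qed.

Lemma state_space_closed (E : normedModType K) (e : E) : `|e| = 1 ->
  closed (state_space e : set (weak (dual E))).
Proof.
move=> e1.
rewrite (_ : state_space e = (\bigcap_(x in [set: E])
    ((fun phi : dual E => phi x : K^o) @^-1` [set z | `|z| <= `|x|])) `&`
    ((fun phi : dual E => phi e : K^o) @^-1` [set 1])); last first.
  apply/seteqP; split=> phi; first move=> /(state_spaceP _ e1)[h1 h2].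
    by split=> [x _|]; [exact: h1|exact: h2].
  by move=> [h1 h2]; apply/state_spaceP => //; split=> // x; exact: h1.
apply: closedI.
  apply: closed_bigI => x _.
  have /continuous_closedP := @weak_dual_eval_continuous E x.
  by apply; apply: (@closed_norm_le K^o); exact: normr_real.
have /continuous_closedP := @weak_dual_eval_continuous E e; apply.
apply: accessible_closed_set1; apply: hausdorff_accessible.
exact: (@norm_hausdorff _ K^o).
Qed.

End dual_constructions.

(** * The Hahn-Banach theorem *)

Section hahn_banach.
Context {R : realType} {k : scalar_kind}.
Local Notation K := (scalars R k).
Context {E : normedModType K}.
Implicit Types (p : E -> R) (x y : E).

(** An inequality for positive scalings is easier to check for infima; using it for the inverse
    scalar restores equality in [sublinearZ]. *)
Definition sublinear p := (forall x y, p (x + y) <= p x + p y) /\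
  (forall t x, 0 < t -> p (embed t *: x) <= t * p x).

Lemma sublinearZ p t x : sublinear p -> 0 < t -> p (embed t *: x) = t * p x.
Proof.
move=> [_ pZ] t0; apply/eqP; rewrite eq_le pZ//=.
have ti0 : 0 < t^-1 by rewrite invr_gt0.
have := pZ _ (embed t *: x) ti0.
rewrite scalerA -rmorphM mulVf ?gt_eqF// rmorph1 scale1r mulrC.
by rewrite ler_pdivlMr// mulrC.
Qed.

Lemma sublinear0 p : sublinear p -> p 0 = 0.
Proof.
move=> sp; have := sublinearZ 0 sp (ltr0n R 2); rewrite scaler0.
by move=> /eqP; rewrite -subr_eq0 mulr_natl mulr2n opprD addrA subrr add0r
  oppr_eq0 => /eqP.
Qed.

Lemma sublinear_geN p x : sublinear p -> - p (- x) <= p x.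
Proof.
move=> sp; rewrite -subr_ge0 opprK -(sublinear0 sp) -(subrr x).
by case: sp => spD _; exact: spD.
Qed.

(** For sublinear [p], this is the largest sublinear minorant of [p] whose value at [- y] is at most
    [- p y]. *)
Definition tilt p y x : R :=
  inf [set p (x + embed t *: y) - t * p y | t in [set t : R | 0 <= t]].

Lemma tilt_has_inf p y x : sublinear p ->
  has_inf [set p (x + embed t *: y) - t * p y | t in [set t : R | 0 <= t]].
Proof.
move=> sp; split; first by exists (p (x + embed 0 *: y) - 0 * p y), 0 => /=.
(* The lower bound comes from t p(y) = p(t y) <= p(- x) + p(x + t y). *)
exists (- p (- x)) => _ [t /= t0 <-].
have -> : t * p y = p (embed t *: y).
  have [->|tN0] := eqVneq t 0; last by rewrite (sublinearZ _ sp)// lt0r tN0.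
  by rewrite mul0r rmorph0 scale0r sublinear0.
rewrite lerBrDl -lerBrDr opprK {1}(_ : embed t *: y = - x + (x + embed t *: y)).
  by rewrite addrC; case: sp.
by rewrite addrA addNr add0r.
Qed.

Lemma tilt_le p y x t : sublinear p -> 0 <= t ->
  tilt p y x <= p (x + embed t *: y) - t * p y.
Proof.
move=> sp t0; apply: ge_inf; first by have [] := tilt_has_inf y x sp.
by exists t.
Qed.

Lemma tilt_ge p y x M :
  (forall t, 0 <= t -> M <= p (x + embed t *: y) - t * p y) ->
  M <= tilt p y x.
Proof.
move=> Mp; apply: lb_le_inf.
  by exists (p (x + embed 0 *: y) - 0 * p y), 0 => /=.
by move=> _ [t t0 <-]; exact: Mp.
Qed.

(** Parameters [t] for [x] and [s] for [x'] combine into [t + s] for [x + x']; scaling by [t] turns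
    the parameter [s] into [t * s]. *)
Lemma tilt_sublinear p y : sublinear p -> sublinear (tilt p y).
Proof.
move=> sp; split=> [x x'|t x t0].
  rewrite -lerBlDr; apply: tilt_ge => t t0; rewrite lerBlDr -lerBlDl.
  apply: tilt_ge => s s0; rewrite lerBlDl.
  apply: (le_trans (tilt_le y _ sp (addr_ge0 t0 s0))).
  rewrite rmorphD scalerDl (addrACA x) mulrDl opprD [leRHS]addrACA lerD2r.
  by case: sp.
rewrite mulrC -ler_pdivrMr//; apply: tilt_ge => s s0.
rewrite ler_pdivrMr//.
apply: (le_trans (tilt_le y _ sp (mulr_ge0 (ltW t0) s0))).
by rewrite rmorphM -scalerA -scalerDr (sublinearZ _ sp t0) -mulrA -mulrBr mulrC.
Qed.

Lemma tilt_le_id p y x : sublinear p -> tilt p y x <= p x.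
Proof.
move=> sp; have := tilt_le y x sp (lexx 0).
by rewrite rmorph0 scale0r addr0 mul0r subr0.
Qed.

Lemma tiltN p y : sublinear p -> tilt p y (- y) <= - p y.
Proof.
move=> sp; have := tilt_le y (- y) sp ler01.
by rewrite rmorph1 scale1r addNr sublinear0// mul1r sub0r.
Qed.

(** Zorn's lemma, with the pointwise infimum as lower bound of a chain; it is finite because - p(-
    x) <= - q(- x) <= q(x) for every minorant [q]. *)
Lemma exists_minimal_sublinear p : sublinear p ->
  exists q, [/\ sublinear q, forall x, q x <= p x &
    forall r, sublinear r -> (forall x, r x <= q x) -> forall x, q x <= r x].
Proof.
move=> sp; pose T := {q : E -> R | sublinear q /\ forall x, q x <= p x}.
pose rl (q r : T) := `[< forall x, sval r x <= sval q x >].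
have sT (q : T) : sublinear (sval q) by case: (svalP q).
have leT (q : T) x : sval q x <= p x by case: (svalP q).
pose p' : T := exist _ p (conj sp (fun x => lexx (p x))).
have [q qmax] : exists q, premaximal rl q.
  apply: (ZL_preorder p') => [q|q r s|A Atot].
  - by apply/asboolP.
  - move=> /asboolP qr /asboolP rs; apply/asboolP => x.
    exact: le_trans (rs x) _.
  - have [[a Aa]|A0] := pselect (A !=set0); last first.
      by exists p' => s As; case: A0; exists s.
    pose V x := [set sval q x | q in A].
    have Vinf x : has_inf (V x).
      split; first by exists (sval a x), a.
      exists (- p (- x)) => _ [q Aq <-].
      by apply: le_trans (sublinear_geN _ (sT q)); rewrite lerN2.
    have Vle q x : A q -> inf (V x) <= sval q x.
      by move=> Aq; apply: ge_inf; [case: (Vinf x)|exists q].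
    have Vge x M : (forall q, A q -> M <= sval q x) -> M <= inf (V x).
      move=> Mq; apply: lb_le_inf; first by case: (Vinf x).
      by move=> _ [q Aq <-]; exact: Mq.
    have sV : sublinear (fun x => inf (V x)).
      split=> [x y|t x t0].
        rewrite -lerBlDr; apply: (Vge _) => q Aq; rewrite lerBlDr -lerBlDl.
        apply: (Vge _) => r Ar; rewrite lerBlDl.
        (* The smaller of [q] and [r] serves for both summands; this is where the chain condition
           enters. *)
        have [/asboolP qr|/asboolP rq] := Atot _ _ Aq Ar.
          apply: (le_trans (Vle r _ Ar)); have [rD _] := sT r.
          by apply: (le_trans (rD _ _)); rewrite lerD2r.
        apply: (le_trans (Vle q _ Aq)); have [qD _] := sT q.
        by apply: (le_trans (qD _ _)); rewrite lerD2l.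
      rewrite mulrC -ler_pdivrMr//; apply: (Vge _) => q Aq.
      rewrite ler_pdivrMr//.
      by rewrite mulrC (le_trans (Vle q _ Aq))//; have [_] := sT q; apply.
    have Vp x : inf (V x) <= p x by exact: le_trans (Vle a x Aa) (leT a x).
    pose V' : T := exist _ (fun x => inf (V x)) (conj sV Vp).
    exists V' => s As; apply/asboolP => x /=.
    exact: Vle.
exists (sval q); split=> // r sr rq.
have rp x : r x <= p x by exact: le_trans (rq x) (leT q x).
pose r' : T := exist _ r (conj sr rp).
by have /asboolP := qmax r' (asboolT rq).
Qed.

(** A minimal sublinear function equals its own tilts, hence is odd and so linear. Minimising below
    [tilt p x0] rather than [p] gives u(- x0) <= - p(x0), which yields equality at [x0]. *)
Lemma exists_linear_le_sublinear p x0 : sublinear p ->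
  exists u : E -> R, [/\ forall x y, u (x + y) = u x + u y,
    forall t x, u (embed t *: x) = t * u x,
    forall x, u x <= p x & u x0 = p x0].
Proof.
move=> sp.
have [u [su up umin]] := exists_minimal_sublinear (tilt_sublinear x0 sp).
have uN x : u (- x) = - u x.
  apply/eqP; rewrite eq_le; apply/andP; split; last first.
    by rewrite -{1}[x]opprK; exact: sublinear_geN.
  apply: le_trans (tiltN x su); apply: umin; first exact: tilt_sublinear.
  by move=> y; exact: tilt_le_id.
have [uD _] := su.
exists u; split.
- move=> x y; apply/eqP; rewrite eq_le uD/= -lerBrDr -uN.
  by rewrite -{1}[x](addrK y); exact: uD.
- move=> t x; have [t0|t0|->] := ltgtP t 0.
  + rewrite -[t]opprK rmorphN scaleNr uN sublinearZ// ?oppr_gt0//.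
    by rewrite -mulNr.
  + exact: (sublinearZ x su t0).
  + by rewrite rmorph0 scale0r mul0r sublinear0.
- by move=> x; exact: le_trans (up x) (tilt_le_id _ _ sp).
- apply/eqP; rewrite eq_le (le_trans (up _) (tilt_le_id _ _ sp))//=.
  by rewrite -lerN2 -uN; exact: le_trans (up _) (tiltN _ sp).
Qed.

End hahn_banach.

(** * Support functionals over real or complex scalars *)

Section norming.
Context {R : realType} {k : scalar_kind}.
Local Notation K := (scalars R k).

(* A real-linear u is the real part of the K-linear x |-> u x - i u (i x). *)
Lemma exists_complexification (E : normedModType K) (u : E -> R) :
  (forall x y, u (x + y) = u x + u y) ->
  (forall t x, u (embed t *: x) = t * u x) ->
  exists phi : E -> K, (forall a x y, phi (a *: x + y) = a * phi x + phi y) /\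
    forall x, repart (phi x) = u x.
Proof.
move: E u; rewrite /embed /repart; case: k => /= E u uD uZ.
  by exists u; split=> // a x y; rewrite uD uZ.
exists (fun x => u x -i* u (Complex 0 1 *: x))%C; split=> // c x y.
have cE z : c *: z = ((complex.Re c)%:C)%C *: z +
    ((complex.Im c)%:C)%C *: (Complex 0 1 *: z).
  rewrite scalerA -scalerDl; congr (_ *: _); case: c => a b.
  apply/eqP; rewrite eq_complex /=.
  by rewrite !(mul0r, mulr0, mulr1, subr0, addr0, add0r, eqxx).
have iE z : Complex 0 1 *: (Complex 0 1 *: z) = ((-1)%:C)%C *: z :> E.
  rewrite scalerA; congr (_ *: _).
  apply/eqP; rewrite eq_complex /=.
  by rewrite !(mul0r, mulr0, mulr1, sub0r, addr0, eqxx).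
have iC (r : R) z :
    Complex 0 1 *: ((r%:C)%C *: z) = (r%:C)%C *: (Complex 0 1 *: z) :> E.
  by rewrite !scalerA mulrC.
apply/eqP; rewrite cE scalerDr !scalerDr !iC iE !uD !uZ eq_complex.
case: c {cE} => a b /=.
apply/andP; split; apply/eqP.
  by rewrite mulrN opprK.
by rewrite !opprD mulN1r !mulrN opprK addrAC.
Qed.

Lemma state_space_neq0 (E : normedModType K) (e : E) : `|e| = 1 ->
  state_space e !=set0.
Proof.
move=> e1; pose p (x : E) : R := repart `|x|.
have sp : sublinear p.
  split=> [x y|t x t0].
    by rewrite -raddfD; apply: ler_repart; exact: ler_normD.
  by rewrite /p normrZ norm_embed repartM gtr0_norm.
have [u [uD uZ up ue]] := exists_linear_le_sublinear e sp.
have [phi [phil phiu]] := exists_complexification uD uZ.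
have phi_le x : `|phi x| <= `|x|.
  have [->|phi0] := eqVneq (phi x) 0; first by rewrite normr0.
  (* Rotating [x] by [c] makes the value of [phi] equal to |phi x|, so the bound on real parts
     becomes a bound on moduli. *)
  pose c := `|phi x| / phi x.
  have c1 : `|c| = 1 by rewrite normrM normfV normr_id divff// normr_eq0.
  have := up (c *: x).
  rewrite -phiu -[c *: x]addr0 phil addr0 /p normrZ c1 mul1r.
  have -> : phi 0 = 0.
    by have := phil (-1) 0 0; rewrite scaler0 addr0 mulN1r addNr.
  rewrite addr0 divfK// -(@ler_embed R k) !real_repartK ?normr_real//.
have [psi psiE] : exists psi : dual E, psi =1 phi.
  by apply: (exists_dual (M := 1)) => // x; rewrite mul1r.
exists psi; apply/state_spaceP => //; split=> [x|]; rewrite psiE//.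
have re : repart (phi e) = 1 by rewrite phiu ue /p e1 repart1.
have ne : repart `|phi e| = 1.
  apply/eqP; rewrite eq_le -{1}(@repart1 R k) -{1}e1 ler_repart//=.
  by rewrite -re repart_le_norm.
by rewrite (@repart_eq_norm _ _ (phi e)) ?re// -(@real_repartK _ _ `|phi e|)
  ?normr_real// ne rmorph1.
Qed.

End norming.

(** * Limits of evaluations in the bidual *)

Section ultrafilter_limits.
Context {R : realType}.

(** The values cluster in a compact segment, and an ultrafilter converges to each of its cluster
    points. *)
Lemma ultra_bounded_cvg_real (I : Type) (U : set_system I) (a : I -> R)
    (M : R) :
  UltraFilter U -> (forall i, `|a i| <= M) -> exists l : R, a @ U --> l.
Proof.
move=> UU aM; have UF := ultra_proper.
have [|l [_ lcl]] := @segment_compact R (- M) M (a @ U) _.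
  by apply: (@filterE _ U) => i; rewrite /= in_itv/= -ler_norml; exact: aM.
exists l => A Al; have [//|UA] := in_ultra_setVsetC (a @^-1` A) UU.
by have [y []] := lcl (~` A) A UA Al.
Qed.

Lemma ultra_bounded_cvg (k : scalar_kind) (I : Type) (U : set_system I)
    (a : I -> scalars R k) (M : scalars R k) :
  UltraFilter U -> (forall i, `|a i| <= M) ->
  exists l : scalars R k, a @ U --> (l : (scalars R k)^o).
Proof.
move=> UU aM; have UF := ultra_proper.
have bnd (b : I -> scalars R k) : (forall i, `|b i| = `|a i|) ->
    exists l : R, (fun i => repart (b i)) @ U --> l.
  move=> ba; apply: (@ultra_bounded_cvg_real _ _ _ (repart M)) => // i.
  by rewrite (le_trans (norm_repart _))// ba ler_repart.
have [l1 al1] := bnd a (fun=> erefl).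
case: k a M aM bnd al1 => a M aM bnd al1; first by exists l1.
pose j : scalars R ComplexScalars := Complex 0 1.
(* The real part of [b i] is the imaginary part of [a i], so the real case handles it too. *)
pose b (i : I) : scalars R ComplexScalars := - j * a i.
have j1 : `|j| = 1.
  by apply/eqP; rewrite eq_complex /= expr0n/= expr1n add0r sqrtr1 !eqxx.
have [|l2 al2] := bnd b; first by move=> i; rewrite normrM normrN j1 mul1r.
exists (embed l1 + embed l2 * j).
have -> : a = fun i => embed (repart (a i)) + embed (repart (b i)) * j.
  apply/funext => i; rewrite /b; case: (a i) => x y.
  apply/eqP; rewrite eq_complex /=.
  by rewrite !(oppr0, mul0r, mulr0, mulr1, sub0r, subr0, addr0, add0r, mulN1r,
    opprK, eqxx).
apply: cvgD; first by apply: continuous_cvg al1; exact: embed_continuous.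
apply: cvgMr_tmp.
by apply: continuous_cvg al2; exact: embed_continuous.
Qed.

(** The limits along [U] exist for each [phi] by boundedness; they depend linearly on [phi] and keep
    the bound [M], so they form an element of the bidual. *)
Lemma exists_bidual_limit (k : scalar_kind) (E : normedModType (scalars R k))
    (I : Type) (U : set_system I) (e : I -> E) (M : scalars R k) :
  UltraFilter U -> (forall i, `|e i| <= M) ->
  exists Phi : dual (dual E), forall phi : dual E,
    phi (e i) @[i --> U] --> (Phi phi : (scalars R k)^o).
Proof.
move=> UU eM; have UF := ultra_proper.
have bnd (phi : dual E) i : `|phi (e i)| <= M * `|phi|.
  by rewrite (le_trans (dual_norm_bound _ _))// mulrC ler_wpM2r.
have /choice[L LP] (phi : dual E) : exists l : scalars R k,
    phi (e i) @[i --> U] --> (l : (scalars R k)^o).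
  exact: (@ultra_bounded_cvg _ _ _ _ (M * `|phi|)).
have [Phi PhiL] : exists Phi : dual (dual E), Phi =1 L.
  apply: (exists_dual (M := M)) => [a phi psi|phi].
    apply: (cvg_unique (@norm_hausdorff _ (scalars R k)^o) (LP _)).
    exact: cvgD (cvgMl_tmp (LP phi)) (LP psi).
  (* Properness of [U] supplies an index, and the bound at that index shows [M * |phi|]
     nonnegative. *)
  have Mphi : M * `|phi| \is Num.real.
    have [i _] := filter_ex (filterT : U setT).
    by rewrite ger0_real// (le_trans _ (bnd phi i)).
  have := @closed_cvg _ _ _ _ _ [set z : (scalars R k)^o | `|z| <= M * `|phi|]
    (closed_norm_le Mphi) _ _ (LP phi).
  by apply; apply: (@filterE _ U) => i; exact: bnd.
by exists Phi => phi; rewrite PhiL.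
Qed.

End ultrafilter_limits.

(** * Vector-valued continuous functions *)

(** Urysohn's lemma, available since a compact Hausdorff space is normal. *)
Lemma exists_bump (R : realType) (Omega : topologicalType)
    (cO : compact [set: Omega]) (hO : hausdorff_space Omega)
    (A : set Omega) (w : Omega) : closed A -> ~ A w ->
  exists u : Omega -> R, [/\ continuous u, forall v, 0 <= u v <= 1,
    u w = 1 & forall v, A v -> u v = 0].
Proof.
move=> Acl Aw.
have /normal_separatorP nO := compact_normal hO cO.
have /(@uniform_separatorP _ R)[u [uc ur u0 u1]] : uniform_separator A [set w].
  apply: nO => //; last first.
    by apply/disjoints_subset => v Av /= vw; rewrite vw in Av.
  exact: (accessible_closed_set1 (hausdorff_accessible hO)).
exists u; split=> // [v||v Av].
- by have := ur (u v); rewrite /= in_itv/=; apply; exists v.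
- by apply: u1; exists w.
- by apply: u0; exists v.
Qed.

Section evaluation.
Context {R : realType} {k : scalar_kind}.
Local Notation K := (scalars R k).
Context {Omega : topologicalType} (cO : compact [set: Omega]).
Context {X : normedModType K}.
Local Notation CX := (contfun cO X).

Definition contfun_eval (w : Omega) (g : CX) : X := g w.

Lemma contfun_eval_is_linear w : linear (contfun_eval w).
Proof. by []. Qed.
HB.instance Definition _ w := GRing.isLinear.Build K CX X *:%R
  (contfun_eval w) (contfun_eval_is_linear w).

Lemma contfun_eval_le (g : CX) w : `|g w| <= `|g|.
Proof. exact: contfun_norm_ub. Qed.

Lemma contfun_eval_continuous w : continuous (contfun_eval w).
Proof.
apply: (@linear_bound_continuous _ _ _ _ _ 1) => g.
by rewrite mul1r contfun_eval_le.
Qed.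

Context (u : Omega -> R) (uc : continuous u).

Lemma embed_fun_continuous : continuous (fun w => embed (u w) : K^o).
Proof.
by move=> w; apply: continuous_comp; [exact: uc|exact: embed_continuous].
Qed.

Lemma fun_scale_continuous (g : Omega -> X) : continuous g ->
  continuous (fun w => embed (u w) *: g w).
Proof.
by move=> gc w; apply: cvgZ; [exact: embed_fun_continuous|exact: gc].
Qed.

Definition contfun_scale (g : CX) : CX :=
  contfun_of cO (fun_scale_continuous (@contfun_continuous _ _ _ _ _ g)).

(** The elementary tensor of [u] and [x]. Its adjoint in [x] localises a functional on [CX] to one
    on [X]. *)
Definition contfun_tensor (x : X) : CX :=
  contfun_of cO (fun_scale_continuous (@cst_continuous Omega X x)).

Lemma contfun_tensorE x w : contfun_tensor x w = embed (u w) *: x.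
Proof. by []. Qed.

Lemma contfun_tensor_is_linear : linear contfun_tensor.
Proof.
move=> a x y; apply: contfun_ext => w.
rewrite -[RHS]/(a *: (embed (u w) *: x) + embed (u w) *: y) contfun_tensorE.
by rewrite scalerDr !scalerA mulrC.
Qed.
HB.instance Definition _ := GRing.isLinear.Build K X CX *:%R
  contfun_tensor contfun_tensor_is_linear.

Lemma contfun_tensor_continuous : (forall w, 0 <= u w <= 1) ->
  continuous contfun_tensor.
Proof.
move=> u01; apply: (@linear_bound_continuous _ _ _ _ _ 1) => x; rewrite mul1r.
apply: contfun_norm_le => // w; rewrite contfun_tensorE normrZ norm_embed.
have /andP[u0 u1] := u01 w.
by rewrite ler_piMl// ger0_norm// -(rmorph1 embed) ler_embed.
Qed.

End evaluation.
Arguments contfun_eval {R k Omega} cO {X}.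
Arguments contfun_eval_continuous {R k Omega} cO {X} w.
Arguments contfun_tensor {R k Omega} cO {X u} uc.
Arguments contfun_tensor_continuous {R k Omega} cO {X u} uc.

(** * States of a function and its peak set *)

Section states.
Context {R : realType} {k : scalar_kind}.
Local Notation K := (scalars R k).
Context {Omega : topologicalType} (cO : compact [set: Omega]).
Context {X : normedModType K}.
Local Notation CX := (contfun cO X).
Variables (f : CX) (f1 : unit_sphere CX f).

Lemma contfun_le1 w : `|f w| <= 1.
Proof. by rewrite (le_trans (contfun_eval_le f w))// f1. Qed.

(** Near a peak point [g] is small by continuity; near any other point half of the gap between |f|
    and 1 survives. Compactness provides one [d] for all points. *)
Lemma peak_set_gap (g : CX) (e : K) : 0 < e ->
  (forall w, `|f w| = 1 -> g w = 0) ->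
  exists2 d : K, 0 < d & forall w, `|g w| <= e \/ `|f w| <= 1 - d.
Proof.
move=> e0 g0.
have /compact_near_coveringP cov := cO.
have near0 : \forall d \near (0 : R)^'+, [set: Omega] `<=`
    (fun w => `|g w| <= e \/ `|f w| <= 1 - embed d).
  apply: cov => w _; have [fw1|fw1] := eqVneq `|f w| 1.
    exists ([set v | `|g v| <= e], setT) => /=; last first.
      by move=> [v d] [/= h _]; left.
    split; last exact: filterT.
    apply: (cvgr0_norm_le g) => //; rewrite -(g0 w fw1).
    exact: contfun_continuous.
  have s0 : 0 < 1 - `|f w| by rewrite subr_gt0 lt_neqAle fw1 contfun_le1.
  have d0 : 0 < (1 - `|f w|) / 2 by rewrite divr_gt0.
  have dr : embed (repart ((1 - `|f w|) / 2)) = (1 - `|f w|) / 2.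
    by rewrite real_repartK// gtr0_real.
  exists ([set v | `|f v| <= 1 - (1 - `|f w|) / 2],
      [set d | d <= repart ((1 - `|f w|) / 2)]) => /=; last first.
    move=> [v d] [/= fv dw]; right; rewrite (le_trans fv)// lerD2l lerN2.
    by rewrite -dr ler_embed.
  split.
    apply: (cvgr_norm_le (f w)); first exact: contfun_continuous.
    by rewrite ltrBrDl -ltrBrDr gtr_pMr// invf_lt1 ?ltr1n.
  by apply: nbhs_right_le; rewrite -(@embed_gt0 R k) dr.
near (0 : R)^'+ => d; exists (embed d); first by rewrite embed_gt0.
have dP : [set: Omega] `<=` (fun w => `|g w| <= e \/ `|f w| <= 1 - embed d).
  by near: d.
by move=> w; exact: dP.
Unshelve. all: by end_near. Qed.

(* The norm grows at most like 1 + t e from f to f + t c g, for every e > 0 and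
   every c of modulus 1, whereas phi takes the value 1 + t |phi g| there when c
   is well chosen. *)
Lemma state_vanish (phi : dual CX) (g : CX) : state_space f phi ->
  (forall w, `|f w| = 1 -> g w = 0) -> phi g = 0.
Proof.
move=> /(state_spaceP _ f1)[phi_le phif] g0.
apply/eqP/negPn/negP => phig; pose e := `|phi g| / 2.
have e0 : 0 < e by rewrite divr_gt0// normr_gt0.
have [d d0 dP] := peak_set_gap e0 g0.
(* With this [t] the term t |g| stays below [d], so |f| + t |g| <= 1 where |f| <= 1 - d; adding 1
   keeps the denominator positive. *)
pose t := d / (`|g| + 1).
have g1 : 0 < `|g| + 1 by rewrite ltr_wpDl.
have t0 : 0 < t by rewrite divr_gt0.
pose c := `|phi g| / phi g.
have c1 : `|c| = 1 by rewrite normrM normfV normr_id divff// normr_eq0.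
pose h : CX := (t * c) *: g + f.
have hle : `|h| <= 1 + t * e.
  have te0 : 0 <= t * e by rewrite mulr_ge0 ?ltW.
  apply: contfun_norm_le => [|w]; first by rewrite addr_ge0.
  rewrite -[h w]/((t * c) *: g w + f w) addrC.
  apply: (le_trans (ler_normD _ _)).
  rewrite normrZ normrM c1 mulr1 (gtr0_norm t0).
  have [ge|fd] := dP w; first by rewrite lerD ?contfun_le1// ler_wpM2l// ltW.
  rewrite (le_trans (lerD fd (lexx _)))// -addrA lerD2l (le_trans _ te0)//.
  rewrite addrC subr_le0 /t mulrAC ler_pdivrMr// ler_wpM2l ?ltW//.
  by rewrite (le_lt_trans (contfun_eval_le g w))// ltrDl.
have := le_trans (phi_le h) hle.
have -> : phi h = 1 + t * `|phi g|.
  by rewrite /h linearP/= phif addrC -[_ *: _]/(t * c * phi g) -mulrA divfK.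
have tp0 : 0 <= 1 + t * `|phi g| by rewrite addr_ge0// mulr_ge0// ltW.
rewrite (ger0_norm tp0) lerD2l ler_pM2l//.
by rewrite /e {1}[`|phi g|]splitr gerDl; move=> /(lt_le_trans e0); rewrite ltxx.
Qed.

End states.

(** * Finite peak sets *)

(** Rotating [a] into the direction of [b] turns the triangle inequality into an equality. *)
Lemma exists_aligning_unit (K : numFieldType) (a b : K) :
  exists2 c : K, `|c| = 1 & `|c * a + b| = `|a| + `|b|.
Proof.
have [->|a0] := eqVneq a 0.
  by exists 1; rewrite ?normr1// mulr0 normr0 !add0r.
have [->|b0] := eqVneq b 0.
  by exists 1; rewrite ?normr1// mul1r normr0 !addr0.
have [na nb] : `|a| != 0 /\ `|b| != 0 by rewrite !normr_eq0.
exists (`|a| / a * (b / `|b|)).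
  by rewrite !normrM !normfV !normr_id !divff// mulr1.
have -> : `|a| / a * (b / `|b|) * a + b = b / `|b| * (`|a| + `|b|).
  by rewrite mulrDr divfK// mulrAC divfK// mulrC.
by rewrite normrM normrM normfV normr_id divff// mul1r ger0_norm// addr_ge0.
Qed.

Section finite_peak_set.
Context {R : realType} {k : scalar_kind}.
Local Notation K := (scalars R k).
Context {Omega : topologicalType} (cO : compact [set: Omega]).
Context {X : normedModType K}.
Local Notation CX := (contfun cO X).
Variables (f : CX) (f1 : unit_sphere CX f).

(* The function u x + (1 - u) f has norm at most 1 whenever x does, and this
   forces psi to attain its norm at f w. *)
Lemma state_component (phi : dual CX) (w : Omega) (u : Omega -> R)
    (uc : continuous u) (u01 : forall v, 0 <= u v <= 1) :
  state_space f phi -> `|f w| = 1 -> u w = 1 ->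
  (forall v, `|f v| = 1 -> v != w -> u v = 0) ->
  ([set embed t *: psi | t in `[0, 1] & psi in state_space (f w)] `|` [set 0])
    (dual_comp (contfun_tensor_continuous cO uc u01) phi).
Proof.
move=> Sphi fw uw u0; set psi := dual_comp _ phi.
have [phi_le phif] := (state_spaceP phi f1).1 Sphi.
set a := psi (f w).
have psi1 x : `|x| <= 1 -> `|psi x + (1 - a)| <= 1.
  move=> x1; pose h : CX := contfun_tensor cO uc x + (f - contfun_scale uc f).
  (* On the peak set [u] vanishes except at [w], so [u] times [f] and the tensor of [u] with [f w]
     agree there; by [state_vanish], [phi] has the value [a] at both. *)
  have -> : psi x + (1 - a) = phi h.
    rewrite /h linearD linearB/= phif; congr (_ + (_ - _)).
    rewrite -[LHS]/(phi (contfun_tensor cO uc (f w))).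
    apply/eqP; rewrite -subr_eq0 -linearB/=; apply/eqP.
    apply: (state_vanish f1 Sphi) => v fv.
    rewrite -[LHS]/(embed (u v) *: f w - embed (u v) *: f v).
    have [->|vw] := eqVneq v w; first by rewrite subrr.
    by rewrite (u0 v fv vw) rmorph0 !scale0r subrr.
  rewrite (le_trans (phi_le h))//; apply: contfun_norm_le => // v.
  have /andP[uv0 uv1] := u01 v.
  rewrite -[h v]/(embed (u v) *: x + (f v - embed (u v) *: f v)).
  rewrite -{1}[f v]scale1r -scalerBl -(rmorph1 embed) -rmorphB.
  rewrite (le_trans (ler_normD _ _))// !normrZ !norm_embed.
  rewrite !ger0_norm ?subr_ge0//.
  rewrite [leRHS](_ : _ = embed (u v) + embed (1 - u v)); last first.
    by rewrite -rmorphD/= addrC subrK rmorph1.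
  by rewrite lerD// ler_piMr ?embed_ge0 ?subr_ge0// (contfun_le1 f1).
have psi_add x : `|x| <= 1 -> `|psi x| + `|1 - a| <= 1.
  move=> x1; have [c c1 <-] := exists_aligning_unit (psi x) (1 - a).
  have := psi1 (c *: x); rewrite linearZ/= normrZ c1 mul1r; exact.
(* Taking [x] to be [f w] gives |a| + |1 - a| <= 1, so [a] lies in [0, 1]; then |psi x| <= 1 - (1 -
   a) = a on the unit ball. *)
have a_ge0 : a = `|a|.
  by apply: norm_add_norm_sub_le1; apply: psi_add; rewrite fw.
have a1 : 0 <= 1 - a.
  apply: le_trans (normr_ge0 (1 - a)) _.
  by rewrite lerBrDl {1}a_ge0; apply: psi_add; rewrite fw.
have psi_le x : `|x| <= 1 -> `|psi x| <= a.
  by move=> /psi_add; rewrite (ger0_norm a1) -lerBrDr opprB addrCA subrr addr0.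
have npsi : `|psi| <= a by exact: dual_norm_le.
have {}psi_le x : `|psi x| <= a * `|x|.
  by rewrite (le_trans (dual_norm_bound _ _))// ler_wpM2r.
(* Either the bound [a] is 0 and [psi] vanishes, or [psi] divided by [a] is a state of [f w]. *)
have [a0|aN0] := eqVneq a 0.
  right; apply: dual_ext => x; apply/eqP.
  by rewrite -normr_le0 (le_trans (psi_le x))// a0 mul0r.
have a_gt0 : 0 < a by rewrite lt0r aN0 a_ge0 normr_ge0.
have ar : embed (repart a) = a by rewrite real_repartK// gtr0_real.
left; exists (repart a).
  rewrite /= in_itv/= -(@embed_ge0 R k) -(@ler_embed R k) ar rmorph1.
  by rewrite (ltW a_gt0)/= -subr_ge0.
exists (a^-1 *: psi); last by rewrite ar scalerA divff// scale1r.
apply/state_spaceP => //; split=> [x|].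
  rewrite -[X in `|X|]/(a^-1 * psi x) normrM normfV (gtr0_norm a_gt0).
  by rewrite mulrC ler_pdivrMr// mulrC.
by rewrite -[LHS]/(a^-1 * a) mulVf.
Qed.

Lemma dual_sumE (E : normedModType K) (I : Type) (s : seq I) (phi : I -> dual E)
  (x : E) : (\sum_(i <- s) phi i) x = \sum_(i <- s) phi i x.
Proof. by elim/big_rec2: _ => // i _ y _ <-. Qed.

Lemma contfun_sumE (I : Type) (s : seq I) (g : I -> CX) (w : Omega) :
  (\sum_(i <- s) g i) w = \sum_(i <- s) g i w.
Proof. by elim/big_rec2: _ => // i _ y _ <-. Qed.

Hypothesis hO : hausdorff_space Omega.

Lemma state_space_weakly_compact :
  finite_set [set w | `|f w| = 1] ->
  (forall w, `|f w| = 1 -> weakly_compact (state_space (f w))) ->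
  weakly_compact (state_space f).
Proof.
move=> /finite_seqP[s0 s0E] Sc; pose s := undup s0.
have sP w : `|f w| = 1 <-> w \in s.
  have E : [set` s0] w <-> w \in s0 by [].
  by rewrite mem_undup -E -s0E.
have su : uniq s by exact: undup_uniq.
have /choice[u uP] (w : Omega) : exists u : Omega -> R, [/\ continuous u,
    forall v, 0 <= u v <= 1, u w = 1 &
    forall v, v \in s -> v != w -> u v = 0].
  have [||u [uc u01 uw u0]] := @exists_bump R _ cO hO [set v | v \in rem w s] w.
  - apply: (accessible_finite_set_closed.1 (hausdorff_accessible hO)).
    exact: finite_seq.
  - by rewrite /= mem_rem_uniq// inE eqxx.
  - exists u; split=> // v vs vw; apply: u0.
    by rewrite /= mem_rem_uniq// inE vw.
have uc w : continuous (u w) by case: (uP w).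
have u01 w v : 0 <= u w v <= 1 by case: (uP w).
pose psi (phi : dual CX) w :=
  dual_comp (contfun_tensor_continuous cO (uc w) (u01 w)) phi.
(* At a peak point [v] only the bump of [v] is nonzero, so [g] minus the sum of the tensors of [u w]
   with [g w] vanishes on the peak set and is killed by [phi]. *)
have phiE (phi : dual CX) : state_space f phi ->
    phi = \sum_(w <- s) dual_comp (contfun_eval_continuous cO w) (psi phi w).
  move=> Sphi; apply: dual_ext => g; apply/eqP; rewrite dual_sumE.
  rewrite -[X in _ == X](linear_sum phi s xpredT
    (fun w => contfun_tensor cO (uc w) (g w))).
  rewrite -subr_eq0 -linearB/=; apply/eqP.
  apply: (state_vanish f1 Sphi) => v /sP vs.
  rewrite -[LHS]/(g v - (\sum_(w <- s) contfun_tensor cO (uc w) (g w)) v).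
  rewrite contfun_sumE (bigD1_seq v)//= big_seq_cond big1 => [|w /andP[ws wv]].
    rewrite addr0 -[X in g v - X]/(embed (u v v) *: g v).
    by have [_ _ -> _] := uP v; rewrite rmorph1 scale1r subrr.
  rewrite -[LHS]/(embed (u w v) *: g w).
  have [_ _ _ ->//] := uP w; last by rewrite eq_sym.
  by rewrite rmorph0 scale0r.
have [|C Cc CP] := @weakly_compact_bigsum R k (dual CX) Omega s
    (fun w => dual_comp (contfun_eval_continuous cO w) @`
      ([set embed t *: psi | t in `[0, 1] & psi in state_space (f w)]
        `|` [set 0])).
  move=> w /sP fw; apply: (@continuous_compact (weak (dual X)) (weak (dual CX))).
    by apply: continuous_subspaceT; exact: weak_dual_comp_continuous.
  by apply: weakly_compact_cone; exact: Sc.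
apply: (@subclosed_compact (weak (dual CX)) _ C) => //.
  exact: state_space_closed.
move=> phi Sphi; rewrite (phiE _ Sphi); apply: CP => w ws.
exists (psi phi w) => //; apply: state_component => //.
- exact/sP.
- by case: (uP w).
- by move=> v /sP vs vw; case: (uP w) => _ _ _; apply.
Qed.

End finite_peak_set.

(** * Weakly compact state spaces *)

(** The sets containing all but finitely many points of [A] form a proper filter. Its cluster point
    is a limit point: a neighbourhood meeting [A] in at most that point would have its complement in
    the filter. *)
Lemma infinite_set_limit_point (T : topologicalType) (A : set T) :
  compact [set: T] -> infinite_set A -> limit_point A !=set0.
Proof.
move=> cT infA; pose F : set_system T := [set B | finite_set (A `\` B)].
have FF : ProperFilter F.
  split; first by rewrite /F/= setD0.
  split; rewrite /F/=.
  - by rewrite setDT.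
  - by move=> P Q AP AQ; rewrite /= setDIr finite_setU.
  - by move=> P Q PQ; apply: sub_finite_set; exact: setDS.
have [w [_ wcl]] := cT F FF (filterT : F setT).
exists w; apply: contrapT; rewrite not_limit_pointE => -[U Uw AU].
have FU : F (~` U).
  by rewrite /F/= setDE setCK; exact: sub_finite_set AU (finite_set1 w).
by have [y []] := wcl _ _ FU Uw.
Qed.

(** Continuity sends [t] to a cluster point of [h \o g], and a convergent filter in a Hausdorff
    space clusters only at its limit. *)
Lemma cluster_cvg_eq (I : Type) (T : topologicalType) (S : topologicalType)
    (G : set_system I) (g : I -> T) (h : T -> S) (t : T) (l : S) :
  hausdorff_space S -> Filter G -> continuous h -> cluster (g @ G) t ->
  (h \o g) @ G --> l -> h t = l.
Proof.
move=> hS FG hc gt gl; apply/esym/hS => A B Al Bht.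
have [y [Ay By]] := gt (h @^-1` A) (h @^-1` B) (gl A Al) (hc t B Bht).
by exists (h y).
Qed.

Section compact_state_space.
Context {R : realType} {k : scalar_kind}.
Local Notation K := (scalars R k).
Context {Omega : topologicalType} (cO : compact [set: Omega]).
Context {X : normedModType K}.
Local Notation CX := (contfun cO X).
Variables (f : CX) (f1 : unit_sphere CX f).

Lemma state_space_eval (w : Omega) (psi : dual X) : `|f w| = 1 ->
  state_space (f w) psi ->
  state_space f (dual_comp (contfun_eval_continuous cO w) psi).
Proof.
move=> fw /(state_spaceP _ fw)[psi_le psif].
apply/state_spaceP => //; split=> // g.
by rewrite (le_trans (psi_le _))// contfun_eval_le.
Qed.

Hypothesis Sc : weakly_compact (state_space f).

Lemma eval_state_space_weakly_compact w : `|f w| = 1 ->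
  weakly_compact (state_space (f w)).
Proof.
move=> fw; have one_cts : continuous (fun _ : Omega => 1 : R).
  exact: cst_continuous.
have one_bounds (v : Omega) : 0 <= (1 : R) <= 1 by rewrite ler01 lexx.
pose const x := contfun_tensor cO one_cts (x : X).
have constE x v : const x v = x.
  by rewrite -[LHS]/(embed 1 *: x) rmorph1 scale1r.
pose r : dual CX -> dual X :=
  dual_comp (contfun_tensor_continuous cO one_cts one_bounds).
(* These are the states for which [phi g] depends only on [g w], so [phi] is [r phi] composed with
   evaluation at [w]. *)
pose A := state_space f `&` \bigcap_(g in [set: CX])
  ((fun phi : dual CX => phi (g - const (g w)) : K^o) @^-1` [set 0]).
have Ac : compact (A : set (weak (dual CX))).
  apply: compact_closedI => //; apply: closed_bigI => g _.
  have /continuous_closedP :=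
    @weak_dual_eval_continuous R k CX (g - const (g w)).
  apply; apply: accessible_closed_set1; apply: hausdorff_accessible.
  exact: (@norm_hausdorff _ K^o).
have -> : state_space (f w) = r @` A.
  apply/seteqP; split=> [psi Spsi|_ [phi [Sphi phiA] <-]].
    exists (dual_comp (contfun_eval_continuous cO w) psi).
      split; first exact: state_space_eval.
      move=> g _; rewrite /= -[LHS]/(psi (g w - const (g w) w)).
      by rewrite constE subrr linear0.
    apply: dual_ext => x.
    by rewrite -[LHS]/(psi (const x w)) constE.
  have [phi_le phif] := (state_spaceP phi f1).1 Sphi.
  apply/state_spaceP => //; split=> [x|].
    rewrite -[X in `|X|]/(phi (const x)) (le_trans (phi_le _))//.
    by apply: contfun_norm_le => // v; rewrite constE.
  rewrite -[LHS]/(phi (const (f w))) -phif; apply/esym/eqP.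
  by rewrite -subr_eq0 -linearB; apply/eqP; exact: phiA.
apply: (@continuous_compact (weak (dual CX)) (weak (dual X))) => //.
by apply: continuous_subspaceT; exact: weak_dual_comp_continuous.
Qed.

Hypothesis hO : hausdorff_space Omega.

(** A double-limit argument: [s2val i w] tends to 0 if the bump [i] shrinks first and to 1 if [w]
    tends to [w0] first, whereas weak compactness equates both iterated limits with [Phi phi0]. *)
Lemma peak_set_finite : finite_set [set w | `|f w| = 1].
Proof.
apply: contrapT => /(infinite_set_limit_point cO)[w0 w0P].
pose L := [set w | `|f w| = 1] `\ w0.
pose I := {u : Omega -> R |
  continuous u & (forall v, 0 <= u v <= 1) /\ u w0 = 1}.
have Ic (i : I) : continuous (s2val i) := s2valP i.
have I01 (i : I) v : 0 <= s2val i v <= 1 by case: (s2valP' i).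
have Iw0 (i : I) : s2val i w0 = 1 by case: (s2valP' i).
pose e (i : I) := contfun_scale (Ic i) f.
have e_le1 i : `|e i| <= 1.
  apply: contfun_norm_le => // w.
  rewrite -[e i w]/(embed (s2val i w) *: f w) normrZ norm_embed.
  have /andP[i0 i1] := I01 i w.
  rewrite ger0_norm// mulr_ile1 ?embed_ge0// ?(contfun_le1 f1)//.
  by rewrite -(rmorph1 embed) ler_embed.
(* Bumps vanishing outside [N]; as [N] shrinks to [w0] these sets generate the filter refined to
   [U]. *)
pose B (N : set Omega) := [set i : I | forall v, ~ N v -> s2val i v = 0].
have BF : ProperFilter (filter_from (nbhs w0) B).
  apply: filter_from_proper; last first.
    move=> N Nw0.
    have [||u [uc u01 uw0 u0]] := @exists_bump R _ cO hO (~` (N^°)) w0.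
    - by apply: open_closedC; exact: open_interior.
    - by move=> /(_ Nw0).
    - exists (exist2 _ _ u uc (conj u01 uw0)) => v Nv.
      apply: u0 => /interior_subset.
      exact: Nv.
  apply: filter_from_filter; first by exists setT; exact: filterT.
  move=> N N' Nw0 N'w0; exists (N `&` N'); first exact: filterI.
  by move=> i iN; split=> v Nv; apply: iN => -[].
have [U [UU BU]] := ultraFilterLemma BF; have UF := @ultra_proper _ _ UU.
have [Phi PhiP] := exists_bidual_limit UU e_le1.
(* A Hahn-Banach state of [f w] composed with evaluation at [w]; off the peak set the value 0 is a
   dummy. *)
have /choice[phi phiP] (w : Omega) : exists phi : dual CX, `|f w| = 1 ->
    state_space f phi /\ forall i, phi (e i) = embed (s2val i w).
  have [fw|fw] := pselect (`|f w| = 1); last by exists 0.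
  have [psi Spsi] := state_space_neq0 fw.
  exists (dual_comp (contfun_eval_continuous cO w) psi) => _; split.
    exact: state_space_eval.
  move=> i; rewrite -[LHS]/(psi (embed (s2val i w) *: f w)) linearZ/=.
  by have [_ ->] := Spsi; rewrite -[LHS]/(_ * 1) mulr1.
have LF : ProperFilter (within L (nbhs w0)).
  apply: within_nbhs_proper => V Vw0; have [v [vw0 fv Vv]] := w0P V Vw0.
  by exists v; split=> //; split=> // /eqP; rewrite (negbTE vw0).
have LL : within L (nbhs w0) L by exact: withinT.
have LS : (phi @ within L (nbhs w0)) (state_space f).
  by apply: filterS LL => w [fw _]; exact: (phiP w fw).1.
have [phi0 [Sphi0 phi0cl]] := Sc _ LS.
have hK := @norm_hausdorff _ K^o.
(* For [w] in [L] the complement of [w] is a neighbourhood of [w0], so the bumps eventually vanish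
   at [w] and [Phi (phi w)] is 0; weak continuity of [Phi] passes this to [phi0]. *)
have Phi0 : Phi phi0 = 0.
  apply: (cluster_cvg_eq hK _ (weak_eval_continuous (phi := Phi)) phi0cl).
  apply: (@cvg_near_cst _ K^o); apply: filterS LL => w [fw ww0].
  apply: (cvg_unique hK (PhiP _)); apply: (@cvg_near_cst _ K^o).
  apply: BU; exists (~` [set w]).
    apply: open_nbhs_nbhs; split; last by move=> /= /esym.
    apply: closed_openC.
    exact: (accessible_closed_set1 (hausdorff_accessible hO)).
  move=> i Bi; rewrite (phiP w fw).2 (Bi w) ?rmorph0//.
  by apply.
(* For a fixed bump the values at [w] tend to its value 1 at [w0], so [phi0 (e i)] is 1 for every
   [i]. *)
have Phi1 : Phi phi0 = 1.
  apply: (cvg_unique hK (PhiP _)); apply: (@cvg_near_cst _ K^o).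
  apply: filterE => i.
  apply: (cluster_cvg_eq hK _ (@weak_dual_eval_continuous _ _ _ (e i)) phi0cl).
  rewrite -(rmorph1 embed) -(Iw0 i).
  apply: (@cvg_trans _
    ((fun w => embed (s2val i w) : K^o) @ within L (nbhs w0))).
    apply: near_eq_cvg; apply: filterS LL => w [fw _] /=.
    by rewrite (phiP w fw).2.
  apply: cvg_within_filter; exact: embed_fun_continuous.
by have := oner_neq0 K; rewrite -Phi1 Phi0 eqxx.
Qed.

End compact_state_space.

Theorem theorem3p10 (R : realType) (k : scalar_kind)
    (Omega : topologicalType) (cO : compact [set: Omega])
    (hO : hausdorff_space Omega)
    (X : completeNormedModType (scalars R k))
    (f : contfun cO X) (f1 : unit_sphere (contfun cO X) f) :
  let Lambda : set Omega := [set w | `|f w| = 1] in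
  ((finite_set Lambda /\
      forall w : Omega, Lambda w -> weakly_compact (state_space (f w))) ->
    weakly_compact (state_space f)) /\
  (weak_star_closure (extreme_points (unit_ball (dual X))) `<=` unit_sphere (dual X) ->
    weakly_compact (state_space f) ->
    finite_set Lambda /\
      forall w : Omega, Lambda w -> weakly_compact (state_space (f w))).
Proof.
move=> Lambda; split=> [[Lfin LSc]|_ Sc].
  exact: state_space_weakly_compact.
split; first exact: peak_set_finite.
by move=> w fw; exact: (eval_state_space_weakly_compact f1).
Qed.
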